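(* Let $N,k$ be positive integers with $N\ge 2k+1$ and let $s\ge 2$. Assume that all roots of $D_{k,s}(x)$ and $D_{k,2s}(x)$ are simple. Then, for $a\in V(K_{s,s})$ and $0\le\ell\le N-1$, we have $$h_{C_N^k\square K_{s,s}}((0,a),(\ell,a))=\frac{2k+s}{2k}h_{C_N^k}(0,\ell)-\frac{N(2k+s)}{2}\left((2s-2)\mathcal A_{k,s}^{(N)}(\ell)+\mathcal A_{k,2s}^{(N)}(\ell)\right).$$ In particular, when $k=1$, $$h_{C_N\square K_{s,s}}((0,a),(\ell,a))=\frac{s+2}{2}\,\ell(N-\ell)+N(s+2)\left(\frac{2s-2}{\sqrt{s+4}}\frac{V_\ell^{(s)}V_{N-\ell}^{(s)}}{V_N^{(s)}}+\frac{1}{\sqrt{2s+4}}\frac{V_\ell^{(2s)}V_{N-\ell}^{(2s)}}{V_N^{(2s)}}\right).$$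
   Context: All graphs are finite, simple and undirected; $\mathbb Z_N=\mathbb Z/N\mathbb Z$. $C_N^k$ is the graph with vertex set $\mathbb Z_N$ in which $x,y$ are adjacent iff $x-y\equiv\pm q\pmod N$ for some $1\le q\le k$; $C_N=C_N^1$. $K_{s,s}$ is the complete bipartite graph with parts of size $s$. The Cartesian product $C_N^k\square G$ has vertex set $\mathbb Z_N\times V(G)$, with $(x,a)$ and $(y,b)$ adjacent iff ($a=b$ and $x,y$ are adjacent in $C_N^k$) or ($x=y$ and $a,b$ are adjacent in $G$). For a finite connected graph $Y$ and $u,v\in V(Y)$, $h_Y(u,v)$ is the expected value of $T_v=\inf\{t\ge 0: Z_t=v\}$ for the simple random walk $(Z_t)$ on $Y$ started at $u$ (each step moves to a uniformly random neighbour). For $\nu>0$, $D_{k,\nu}(x)=k+\frac{\nu}{2}-\sum_{q=1}^{k}T_q\left(\frac{x}{2}\right)$, where $T_q$ is the Chebyshev polynomial of the first kind; it has degree $k$. When its roots are simple, they are denoted $\phi_{\nu,1},\ldots,\phi_{\nu,k}\in\mathbb C$, and one chooses complex numbers with $\rho_{\nu,c}+\rho_{\nu,c}^{-1}=\phi_{\nu,c}$, $\rho_{\nu,c}=\eta_{\nu,c}^{2}$, and puts $\gamma_{\nu,c}=\eta_{\nu,c}+\eta_{\nu,c}^{-1}$. The sequence $(V_n^{(\nu,c)})_{n\ge0}$ is defined by $V_0^{(\nu,c)}=0$, $V_1^{(\nu,c)}=1$, $V_{n+2}^{(\nu,c)}=\gamma_{\nu,c}V_{n+1}^{(\nu,c)}-V_n^{(\nu,c)}$,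 and $$\mathcal A_{k,\nu}^{(N)}(\ell)=\sum_{c=1}^{k}\frac{1}{\gamma_{\nu,c}D_{k,\nu}'(\phi_{\nu,c})}\frac{V_\ell^{(\nu,c)}V_{N-\ell}^{(\nu,c)}}{V_N^{(\nu,c)}}.$$ For the case $k=1$, the sequence $(V_n^{(\nu)})_{n\ge 0}$ is defined by $V_0^{(\nu)}=0$, $V_1^{(\nu)}=1$, $V_{n+2}^{(\nu)}=\sqrt{\nu+4}\,V_{n+1}^{(\nu)}-V_n^{(\nu)}$. *)

(* Defs.v *)
From HB Require Import structures.
From mathcomp Require Import all_boot all_order all_algebra.
From mathcomp Require Import all_classical all_reals all_analysis.
From mathcomp Require Export complex.

Set Implicit Arguments.
Unset Strict Implicit.
Unset Printing Implicit Defensive.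

Import Order.TTheory GRing.Theory Num.Theory.
Local Open Scope classical_set_scope.
Local Open Scope ring_scope.

(* A graph on a finite vertex set is given by its adjacency relation.         *)

(* In 'Z_N, which is the ring Z/NZ only for N >= 2. *)
Definition circulant_adj (N k : nat) : rel 'Z_N :=
  [rel x y | [exists q : 'I_k, (x - y == q.+1%:R) || (x - y == - q.+1%:R)]].

(* The boolean is the side of the bipartition. *)
Definition complete_bip_adj (s : nat) : rel (bool * 'I_s) :=
  [rel a b | a.1 != b.1].

Definition cart_adj (T U : finType) (e : rel T) (f : rel U) : rel (T * U) :=
  [rel x y | (x.2 == y.2) && e x.1 y.1 || (x.1 == y.1) && f x.2 y.2].

Section RandomWalk.
Context {R : realType} {d : measure_display} {Omega : measurableType d}.
Context (P : probability Omega R) (V : finType).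

Definition step_prob (e : rel V) (x y : V) : R :=
  if e x y then (#|[set z | e x z]%SET|%:R)^-1 else 0.

(* The last clause is the Markov property in multiplicative form: conditionally
   on any history x 0, ..., x n, the next vertex is a uniform neighbour of x n. *)
Definition simple_random_walk (e : rel V) (u : V) (Z : nat -> Omega -> V) :
    Prop :=
  [/\ forall t x, measurable [set w | Z t w = x],
      P [set w | Z 0%N w = u] = 1%E
    & forall (n : nat) (x : nat -> V),
        P [set w | forall i, (i <= n.+1)%N -> Z i w = x i] =
        (P [set w | forall i, (i <= n)%N -> Z i w = x i] *
         (step_prob e (x n) (x n.+1))%:E)%E].

(* Takes the value +oo when v is never visited. *)
Definition hitting_time (Z : nat -> Omega -> V) (v : V) (w : Omega) : \bar R :=
  ereal_inf [set (t%:R : R)%:E | t in [set t : nat | Z t w = v]].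

Definition mean_hitting_time (Z : nat -> Omega -> V) (v : V) : \bar R :=
  (\int[P]_w hitting_time Z v w)%E.

End RandomWalk.

Fixpoint chebT (F : nzRingType) (n : nat) : {poly F} :=
  match n with
  | 0%N => 1
  | 1%N => 'X
  | (m.+1 as p).+1 => 2%:R *: 'X * chebT F p - chebT F m
  end.

Definition Dpoly (F : fieldType) (k : nat) (nu : F) : {poly F} :=
  (k%:R + nu / 2%:R)%:P
  - \sum_(1 <= q < k.+1) (chebT F q \Po (2%:R^-1 *: 'X)).

Definition simple_roots (F : fieldType) (p : {poly F}) : Prop :=
  forall x, root p x -> mup x p = 1%N.

(* phi enumerates the roots of D_{k,nu} without repetition, and rho, eta are
   the chosen numbers.  The condition rho c != 0 matters because 0^-1 = 0.    *)
Definition root_choice (F : fieldType) (k : nat) (nu : F)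
    (phi rho eta : 'I_k -> F) : Prop :=
  [/\ injective phi,
      forall x, root (Dpoly k nu) x <-> exists c, phi c = x,
      forall c, rho c != 0 /\ rho c + (rho c)^-1 = phi c
    & forall c, rho c = eta c ^+ 2].

Fixpoint Vseq (F : nzRingType) (g : F) (n : nat) : F :=
  match n with
  | 0%N => 0
  | 1%N => 1
  | (m.+1 as p).+1 => g * Vseq g p - Vseq g m
  end.

Definition gamma_of (F : fieldType) (k : nat) (eta : 'I_k -> F) (c : 'I_k) : F :=
  eta c + (eta c)^-1.

Definition Asum (F : fieldType) (k : nat) (nu : F) (phi eta : 'I_k -> F)
    (N l : nat) : F :=
  \sum_(c < k)
    1 / (gamma_of eta c * (Dpoly k nu)^`().[phi c])
    * (Vseq (gamma_of eta c) l * Vseq (gamma_of eta c) (N - l)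
       / Vseq (gamma_of eta c) N).

(* Main.v *)
Require Import Defs.
From HB Require Import structures.
From mathcomp Require Import all_boot all_order all_algebra.
From mathcomp Require Import all_classical all_reals all_analysis.
From mathcomp Require Import complex measurable_realfun ring lra zify.

(* The mean hitting time from u is read off any solution h of h v = 0,
   h = 1 + (average of h over the neighbours) away from v: the quantity
   E[min(n, T)] + E[h(Z_n); T > n] does not depend on n, so E[T] <= h u + sup |h|
   is finite, P(T > n) tends to 0, and E[T] = h u.

   For the product graph the unit mass at a in K_{s,s} splits into Laplacian
   eigenvectors of eigenvalues 0, s and 2s, which separates the equation into
   lap H = 2k (away from the target) and (lap + nu) G = delta_0 on the cycle for
   nu = s, 2s.  With A the adjacency operator of C_N, lap + nu = 2 D_{k,nu}(A), so
   the partial fractions of 1/D_{k,nu} reduce G to the resolvents of A at the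
   roots phi_c = rho + 1/rho, proportional to rho^x + rho^(N-x). *)

Set Implicit Arguments.
Unset Strict Implicit.
Unset Printing Implicit Defensive.

Import Order.TTheory GRing.Theory Num.Theory.
Import numFieldNormedType.Exports.
Local Open Scope complex_scope.
Local Open Scope ring_scope.

(** * Mean hitting times from the averaging equation *)

Section HittingTimes.
Local Open Scope classical_set_scope.
Context {R : realType} {d : measure_display} {Omega : measurableType d}.
Context (P : probability Omega R).

Let pr (A : set Omega) : R := fine (P A).

Let pr_ge0 A : 0 <= pr A.
Proof. exact/fine_ge0/measure_ge0. Qed.

Let prE A : measurable A -> (pr A)%:E = P A.
Proof. by move=> mA; rewrite fineK// fin_num_measure. Qed.

Let fiber_sum (I : finType) (X : Omega -> I) (A : set Omega) :
  measurable A -> (forall i, measurable [set w | X w = i]) ->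
  pr A = \sum_(i : I) pr (A `&` [set w | X w = i]).
Proof.
have finI : finite_set [set: I] by exact: finite_finset.
move=> mA mX; apply: EFin_inj; rewrite prE// -sumEFin.
transitivity (\sum_(i : I) P (A `&` [set w | X w = i]))%E; last first.
  by apply: eq_bigr => i _; rewrite prE//; exact: measurableI.
transitivity (P (\bigcup_(i in [set: I]) (A `&` [set w | X w = i]))).
  by congr (P _); apply/seteqP; split=> [w Aw|w [i _ []]//]; exists (X w).
rewrite measure_fin_bigcup//; last 2 first.
- by move=> i j _ _ [w [[_ <-] [_ <-]]].
- by move=> i _; exact: measurableI.
rewrite fsbig_finite//=; apply: perm_big; apply: uniq_perm.
- exact: finmap.fset_uniq.
- exact: index_enum_uniq.
- by move=> i; rewrite mem_index_enum in_fset_set// in_setT.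
Qed.

Section Walk.
Context (V : finType) (e : rel V) (u v : V) (Z : nat -> Omega -> V).
Hypothesis walkZ : simple_random_walk P e u Z.

Let hist n w : {ffun 'I_n.+1 -> V} := [ffun i : 'I_n.+1 => Z i w].

(** The Markov clause quantifies over sequences on [nat], so a finite history followed by [y] is
    extended to one, constant after time n. *)
Let path n (p : {ffun 'I_n.+1 -> V}) (y : V) (i : nat) : V :=
  if (i <= n)%N then p (inord i) else y.

Let histE n p y :
  [set w | hist n w = p] = [set w | forall i, (i <= n)%N -> Z i w = path p y i].
Proof.
apply/seteqP; split=> w /=.
  by move=> <- i ilen; rewrite /path ilen ffunE inordK.
move=> wp; apply/ffunP => i; rewrite ffunE wp; last by rewrite -ltnS.
by rewrite /path -ltnS ltn_ord inord_val.
Qed.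

Let hist_nextE n p y :
  [set w | hist n w = p] `&` [set w | Z n.+1 w = y] =
  [set w | forall i, (i <= n.+1)%N -> Z i w = path p y i].
Proof.
rewrite (histE _ y); apply/seteqP; split=> w /=.
  move=> [wp Zy] i; rewrite leq_eqVlt => /orP[/eqP->|]; last exact: wp.
  by rewrite /path ltnn.
move=> wp; split=> [i ilen|]; first by rewrite wp// ltnW.
by rewrite wp// /path ltnn.
Qed.

Let mZ t x : measurable [set w | Z t w = x].
Proof. by case: walkZ. Qed.

Let mhist n p : measurable [set w | hist n w = p].
Proof.
rewrite (_ : [set _ | _] = \bigcap_(i in [set: 'I_n.+1]) [set w | Z i w = p i]).
  exact: fin_bigcap_measurable.
apply/seteqP; split=> [w /= <- i _/=|w /= wp]; first by rewrite ffunE.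
by apply/ffunP => i; rewrite ffunE wp.
Qed.

Let mhist_pred n (B : pred {ffun 'I_n.+1 -> V}) :
  measurable [set w | B (hist n w)].
Proof.
rewrite (_ : [set _ | _] = \bigcup_(p in [set` B]) [set w | hist n w = p]).
  by apply: fin_bigcup_measurable => //; exact: finite_finset.
by apply/seteqP; split=> [w /= Bw|w [p /= Bp wp]]; [exists (hist n w)|rewrite /= wp].
Qed.

(** The walk hypothesis conditions on one full history. Summing over the histories that satisfy [B]
    and end at [x] gives the rule for every event of the past; the other histories contribute 0 to
    both sides. *)
Let markov n (B : pred {ffun 'I_n.+1 -> V}) x y :
  pr ([set w | B (hist n w)] `&` [set w | Z n w = x] `&` [set w | Z n.+1 w = y]) =
  pr ([set w | B (hist n w)] `&` [set w | Z n w = x]) * step_prob e x y.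
Proof.
have mBx : measurable ([set w | B (hist n w)] `&` [set w | Z n w = x]).
  exact: measurableI.
rewrite (fiber_sum (measurableI _ _ mBx (mZ n.+1 y)) (@mhist n)).
rewrite (fiber_sum mBx (@mhist n)).
rewrite mulr_suml; apply: eq_bigr => p _.
have [Bp|nBp] := boolP (B p && (p ord_max == x)); last first.
  have E0 : [set w | B (hist n w)] `&` [set w | Z n w = x]
      `&` [set w | hist n w = p] = set0.
    apply/seteqP; split=> w //= -[[Bw Zw] wp]; move/negP: nBp; apply.
    by rewrite -wp Bw ffunE Zw/=.
  rewrite E0 [X in pr X = _](_ : _ = set0); last first.
    by rewrite -[LHS]setIA [X in _ `&` X]setIC setIA E0 set0I.
  by rewrite /pr measure0 mul0r.
have /andP[{}Bp /eqP px] := Bp.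
have -> : [set w | B (hist n w)] `&` [set w | Z n w = x]
    `&` [set w | hist n w = p] = [set w | hist n w = p].
  apply/seteqP; split=> [w []//|w /= wp]; split=> //; split; rewrite ?wp//.
  by rewrite -px -wp ffunE.
have -> : [set w | B (hist n w)] `&` [set w | Z n w = x]
    `&` [set w | Z n.+1 w = y] `&` [set w | hist n w = p] =
    [set w | hist n w = p] `&` [set w | Z n.+1 w = y].
  apply/seteqP; split=> [w [[[_ _] Zy] wp]//|w [/= wp Zy]]; split=> //.
  by split=> //; split; rewrite ?wp// -px -wp ffunE.
apply: EFin_inj; rewrite EFinM !prE//; last exact: measurableI.
rewrite hist_nextE (histE p y); case: walkZ => _ _ ->.
rewrite /path leqnn ltnn; congr (_ * (step_prob _ _ _)%:E)%E.
by rewrite -[RHS]px; congr (p _); apply/val_inj; rewrite /= inordK.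
Qed.

Let avoids n := [set w | forall i, (i <= n)%N -> Z i w <> v].

Let avoidsE n :
  avoids n = [set w | [forall i, hist n w i != v]].
Proof.
apply/seteqP; split=> w /=.
  by move=> av; apply/forallP => i; rewrite ffunE; apply/eqP; apply: av; rewrite -ltnS.
move=> /forallP av i ilen; apply/eqP; have := av (Ordinal (ilen : (i < n.+1)%N)).
by rewrite ffunE.
Qed.

Let mavoids n : measurable (avoids n).
Proof. by rewrite avoidsE; exact: (mhist_pred (fun p => [forall i, p i != v])). Qed.

(** The law of the walk killed at [v]: the probability that T > n and Z_n = x. *)
Let f n x := pr (avoids n `&` [set w | Z n w = x]).

Let sum_f n : \sum_x f n x = pr (avoids n).
Proof. by rewrite [RHS](fiber_sum (X := Z n)). Qed.

Let f_v n : f n v = 0.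
Proof.
rewrite /f (_ : avoids n `&` [set w | Z n w = v] = set0) ?/pr ?measure0//.
by apply/seteqP; split=> w //= -[/(_ n (leqnn n))].
Qed.

Let f_next n y : y != v -> f n.+1 y = \sum_x f n x * step_prob e x y.
Proof.
move=> yv; rewrite /f.
have -> : avoids n.+1 `&` [set w | Z n.+1 w = y] =
          avoids n `&` [set w | Z n.+1 w = y].
  apply/seteqP; split=> w [av /= Zy]; split=> //= i ilen; first exact/av/ltnW.
  by move: ilen; rewrite leq_eqVlt => /orP[/eqP->|/av//]; rewrite Zy; apply/eqP.
rewrite (fiber_sum (measurableI _ _ (mavoids n) (mZ n.+1 y)) (mZ n)).
apply: eq_bigr => x _; rewrite setIAC avoidsE.
by rewrite (markov (fun p : {ffun 'I_n.+1 -> V} => [forall i, p i != v])).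
Qed.

(** T is the sum over n of the indicators of T > n, also when T is infinite. *)
Let hitting_time_series w :
  hitting_time (R := R) Z v w = (\sum_(n <oo) (\1_(avoids n) w : R)%:E)%E.
Proof.
have [[n0 Zn0]|noZ] := pselect (exists n, Z n w = v); last first.
  have av n : w \in avoids n by rewrite inE => i _ Ziv; apply: noZ; exists i.
  rewrite /hitting_time [X in image X](_ : _ = set0) ?image_set0 ?ereal_inf0; last first.
    by apply/seteqP; split=> t //= Zt; apply: noZ; exists t.
  (* The infimum of the empty set is +oo. Every indicator is 1, so the n-th partial sum is n and
     eventually exceeds any [A]. *)
  apply/esym/cvg_lim => //; apply/cvgeyPge => A; near=> n.
  rewrite (eq_bigr (fun=> 1%:E)) => [|i _]; last by rewrite indicE av.
  rewrite sumEFin big_mkord sumr_const card_ord lee_fin.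
  rewrite (le_trans (ler_norm A))// (le_trans (ltW (truncnS_gt _)))// ler_nat.
  by near: n; exists (Num.truncn `|A|).+1.
have exZ : exists n, Z n w == v by exists n0; apply/eqP.
case: (ex_minnP exZ) => m /eqP Zm minm.
have av n : (w \in avoids n) = (n < m)%N.
  apply/idP/idP; rewrite inE.
    by move=> avn; rewrite ltnNge; apply/negP => /avn /(_ Zm).
  move=> ltnm i ilen /eqP /minm; rewrite leqNgt => /negP; apply.
  exact: leq_ltn_trans ltnm.
transitivity ((m%:R : R)%:E).
  apply/eqP; rewrite eq_le; apply/andP; split.
    by apply: ereal_inf_lbound; exists m.
  by apply: le_ereal_inf_tmp => _ [t /eqP /minm mt <-]; rewrite lee_fin ler_nat.
rewrite (nneseries_split 0 m) => [|k _]; last by rewrite lee_fin.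
rewrite eseries0 ?adde0 => [|i mi _]; last by rewrite indicE av ltnNge mi.
rewrite add0n big_mkord (eq_bigr (fun=> 1%:E)) => [|i _]; last first.
  by rewrite indicE av ltn_ord.
by rewrite sumEFin sumr_const card_ord.
Unshelve. all: by end_near.
Qed.

Let F n := pr (avoids n).

(** The first sum is E[min(n, T)], the second E[h(Z_n); T > n]. Expanding [h] by its averaging
    equation splits the second sum into [F n] and its own successor; mass that enters [v] is lost
    harmlessly because [h v = 0]. *)
Let exit_balance (h : V -> R) : h v = 0 ->
  (forall x, x != v -> h x = 1 + \sum_y step_prob e x y * h y) ->
  forall n, \sum_(0 <= m < n) F m + \sum_x f n x * h x = h u.
Proof.
move=> hv hx; elim=> [|n <-].
  rewrite big_nil add0r (bigD1 u)//= big1 ?addr0 => [|x xu].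
    have [->|uv] := eqVneq u v; first by rewrite hv mulr0.
    suff -> : f 0%N u = 1 by rewrite mul1r.
    apply: EFin_inj; rewrite /f prE; last exact: measurableI.
    case: walkZ => _ Pu _; rewrite -[RHS]Pu; congr (P _).
    apply/seteqP; split=> [w []//|w /= Zu].
    by split=> // i; rewrite leqn0 => /eqP-> ; rewrite Zu; apply/eqP.
  suff -> : f 0%N x = 0 by rewrite mul0r.
  apply/eqP; rewrite eq_le pr_ge0 andbT.
  rewrite -lee_fin prE; last exact: measurableI.
  have Pu0 : P (~` [set w | Z 0%N w = u]) = 0%:E.
    by rewrite probability_setC//; case: walkZ => _ Pu _; rewrite Pu subee.
  rewrite -[leRHS]Pu0.
  apply: le_measure; rewrite ?inE; [exact: measurableI|exact: measurableC|].
  by move=> w [_ /= -> ]; apply/eqP.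
rewrite big_nat_recr//= -addrA; congr (_ + _).
transitivity (\sum_x f n x + \sum_x f n x * \sum_y step_prob e x y * h y).
  rewrite sum_f; congr (_ + _); under [RHS]eq_bigr do rewrite mulr_sumr.
  rewrite exchange_big/=; apply: eq_bigr => y _.
  under [RHS]eq_bigr do rewrite mulrA.
  rewrite -mulr_suml; have [->|yv] := eqVneq y v; first by rewrite hv !mulr0.
  by rewrite f_next.
rewrite -big_split/=; apply: eq_bigr => x _.
have [->|xv] := eqVneq x v; first by rewrite f_v !mul0r addr0.
by rewrite [in RHS]hx// mulrDr mulr1.
Qed.

Lemma mean_hitting_timeE (h : V -> R) : h v = 0 ->
  (forall x, x != v -> h x = 1 + \sum_y step_prob e x y * h y) ->
  mean_hitting_time P Z v = (h u)%:E.
Proof.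
move=> hv hx; have bal := exit_balance hv hx.
(* This sum serves as a bound for the supremum of |h|. *)
pose C := \sum_x `|h x|.
have C_ge n : `|\sum_x f n x * h x| <= C * F n.
  rewrite mulrC /F -sum_f (le_trans (ler_norm_sum _ _ _))// mulr_suml.
  apply: ler_sum => x _; rewrite normrM (ger0_norm (pr_ge0 _)).
  rewrite ler_wpM2l ?pr_ge0// /C (bigD1 x)//= lerDl sumr_ge0//.
have C0 : 0 <= C by apply: sumr_ge0.
have F_ge0 n : 0 <= F n by exact: pr_ge0.
have F_le1 n : F n <= 1 by rewrite -lee_fin prE// probability_le1.
have serE n : series F n = h u - \sum_x f n x * h x.
  by rewrite /series/= -(bal n) addrK.
have cvF : cvgn (series F : nat -> R).
  apply: nondecreasing_is_cvgn; first exact: nondecreasing_series.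
  exists (h u + C) => _ [n _ <-]; rewrite serE lerD2l.
  rewrite (le_trans (ler_norm _))// normrN (le_trans (C_ge n))//.
  by rewrite ler_piMr.
have cv0 : (fun n => \sum_x f n x * h x : R) @ \oo --> (0 : R).
  apply/norm_cvg0P; apply: (@squeeze_cvgr _ _ _ _ (cst 0) (fun n => C * F n)).
  - by apply: nearW => n; rewrite normr_ge0 C_ge.
  - exact: cvg_cst.
  - by rewrite -(mulr0 C); apply: cvgMr; exact: cvg_series_cvg_0.
have cvh : (series F : nat -> R) @ \oo --> h u.
  rewrite (_ : series F = fun n => h u - \sum_x f n x * h x); last exact/funext.
  by rewrite -[X in _ --> X]subr0; apply: cvgB => //; exact: cvg_cst.
rewrite /mean_hitting_time; under eq_integral do rewrite hitting_time_series.
(* The terms are nonnegative, so the integral passes through the series and E[T] becomes the sum of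
   the [F n]. *)
rewrite integral_nneseries//; last first.
  by move=> n; exact/measurable_EFinP/measurable_indic.
rewrite (eq_eseriesr (g := fun n => (F n)%:E)); last first.
  by move=> n _; rewrite integral_indic// setIT prE.
apply/cvg_lim => //.
rewrite [X in X @ _ --> _](_ : _ = EFin \o series F).
  by apply: cvg_EFin => //; exact: nearW.
by apply/funext => n /=; rewrite sumEFin.
Unshelve. all: by end_near.
Qed.

End Walk.
End HittingTimes.

(** * Arithmetic in Z/N and neighbour sums in the circulant graph *)

Section Circulant.
Context (N : nat) (N_gt1 : (1 < N)%N).

Let ZpN : (Zp_trunc N).+2 = N.
Proof. exact: Zp_cast. Qed.

Lemma val_Zp_lt (z : 'Z_N) : (z < N)%N.
Proof. by rewrite -[X in (_ < X)%N]ZpN. Qed.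

Lemma Zp_natr_inj m n : (m < N)%N -> (n < N)%N ->
  m%:R = n%:R :> 'Z_N -> m = n.
Proof.
by move=> mN nN /(congr1 val); rewrite /= !val_Zp_nat// !modn_small.
Qed.

Lemma Zp_natr_neq0 m : (0 < m < N)%N -> m%:R != 0 :> 'Z_N.
Proof.
move=> /andP[m0 mN]; apply/eqP => /(@Zp_natr_inj m 0 mN (ltnW N_gt1)) m00.
by rewrite m00 in m0.
Qed.

(** The only wrap-around is from N - 1 to 0, and [phi N = phi 0] absorbs it. *)
Lemma Zp_nextE (T : Type) (phi : nat -> T) (z : 'Z_N) : phi N = phi 0%N ->
  phi (z + 1 : 'Z_N) = phi z.+1.
Proof.
move=> phiN; rewrite -[X in nat_of_ord (X + _)]natr_Zp natr1 val_Zp_nat//.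
have := val_Zp_lt z; rewrite leq_eqVlt => /orP[/eqP->|zN].
  by rewrite modnn phiN.
by rewrite modn_small.
Qed.

Lemma Zp_prevE (T : Type) (phi : nat -> T) (z : 'Z_N) :
  phi (z - 1 : 'Z_N) = phi (if z == 0 then N.-1 else z.-1).
Proof.
congr phi; rewrite -[X in nat_of_ord (X - _)]natr_Zp.
have [->|z0] := eqVneq z 0.
  rewrite sub0r; have -> : -1 = N.-1%:R :> 'Z_N.
    apply/eqP; rewrite eq_sym -subr_eq0 opprK natr1 prednK ?(ltnW N_gt1)//.
    by apply/eqP/val_inj; rewrite /= val_Zp_nat// modnn.
  by rewrite val_Zp_nat// modn_small// prednK// ltnW.
have zgt0 : (0 < z)%N by rewrite lt0n.
rewrite -{1}(prednK zgt0) -natr1 addrK val_Zp_nat// modn_small//.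
by rewrite (leq_ltn_trans (leq_pred _))// val_Zp_lt.
Qed.

Section Neighbours.
Context (k : nat) (N_ge : (2 * k + 1 <= N)%N).

(** Since 2k < N, the 2k signed steps are distinct residues, so each neighbour is counted exactly
    once on the right. *)
Lemma circulant_neighbours (F : nmodType) (f : 'Z_N -> F) x :
  \sum_(y | @circulant_adj N k x y) f y =
  \sum_(q < k) (f (x + q.+1%:R) + f (x - q.+1%:R)).
Proof.
pose g (p : 'I_k * bool) : 'Z_N :=
  if p.2 then x + p.1.+1%:R else x - p.1.+1%:R.
have lek (q : 'I_k) : (q.+1 <= k)%N by [].
have sum_neq0 (q q' : 'I_k) : (q.+1%:R == - q'.+1%:R :> 'Z_N) = false.
  rewrite -subr_eq0 opprK -natrD; apply/negbTE/Zp_natr_neq0.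
  by have := lek q; have := lek q'; lia.
have g_inj : injective g.
  move=> [q b] [q' b']; rewrite /g/=; case: b; case: b' => /addrI.
  - move=> /Zp_natr_inj qq; congr (_, _); apply/val_inj/succn_inj/qq.
      by have := lek q; lia.
    by have := lek q'; lia.
  - by move=> /eqP; rewrite sum_neq0.
  - by move=> /esym/eqP; rewrite sum_neq0.
  - move=> /oppr_inj/Zp_natr_inj qq; congr (_, _); apply/val_inj/succn_inj/qq.
      by have := lek q; lia.
    by have := lek q'; lia.
transitivity (\sum_(y in [set g p | p in [set: 'I_k * bool]]%SET) f y).
  apply: eq_bigl => y; rewrite /circulant_adj/=.
  apply/existsP/imsetP => [[q /orP[/eqP xy|/eqP xy]]|[[q []] _ ->]].
  - by exists (q, false); rewrite ?inE// /g/= -xy opprB addrC subrK.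
  - exists (q, true); rewrite ?inE// /g/=.
    by rewrite -[q.+1%:R]opprK -xy opprB addrC subrK.
  - by exists q; rewrite /g/= opprD addNKr eqxx orbT.
  - by exists q; rewrite /g/= opprB addrC subrK eqxx.
rewrite big_imset/=; last by move=> p p' _ _ /g_inj.
rewrite (eq_bigl xpredT) => [|p]; last by rewrite inE.
rewrite -(pair_bigA _ (fun q b => f (g (q, b))))/=.
by apply: eq_bigr => q _; rewrite big_bool.
Qed.

End Neighbours.
End Circulant.

(** A sum of negated second differences; for N >= 2k + 1 it is the graph Laplacian of C_N^k. Values
    in a bare [zmodType] allow transfer along additive maps from [R[i]] to [R]. *)
Definition lap (F : zmodType) (N k : nat) (f : 'Z_N -> F) (x : 'Z_N) : F :=
  \sum_(q < k) (f x *+ 2 - (f (x + q.+1%:R) + f (x - q.+1%:R))).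

Lemma lapE (F : zmodType) (N k : nat) (f : 'Z_N -> F) x :
  lap k f x = f x *+ (2 * k) - \sum_(q < k) (f (x + q.+1%:R) + f (x - q.+1%:R)).
Proof. by rewrite /lap sumrB sumr_const card_ord -mulrnA. Qed.

(** * Chebyshev polynomials and partial fractions *)

Section Resolvent.
Context (F : fieldType).

Lemma VseqSS (g : F) n : Vseq g n.+2 = g * Vseq g n.+1 - Vseq g n.
Proof. by []. Qed.

Lemma chebTSS n : chebT F n.+2 = 2%:R *: 'X * chebT F n.+1 - chebT F n.
Proof. by []. Qed.

(** The product form avoids dividing by [eta - eta^-1], which vanishes when [eta ^+ 2 = 1]. *)
Lemma Vseq_closed (eta : F) n : eta != 0 ->
  (eta - eta^-1) * Vseq (eta + eta^-1) n = eta ^+ n - eta ^- n.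
Proof.
move=> eta0; elim/ltn_ind: n => -[|[|n]] IH.
- by rewrite mulr0 expr0 invr1 subrr.
- by rewrite mulr1 !expr1.
rewrite VseqSS mulrBr mulrCA !IH//.
by rewrite !exprS; field; rewrite eta0 expf_neq0.
Qed.

(* [2 T_q(x/2)], the polynomial sending [r + r^-1] to [r^q + r^-q] *)
Definition cheb2 q : {poly F} := 2%:R *: (chebT F q \Po (2%:R^-1 *: 'X)).

Hypothesis two_neq0 : 2%:R != 0 :> F.

(** Both sides satisfy the same two-term recurrence. One statement serves evaluation at rho + 1/rho
    and substitution of a matrix that is a sum of two inverse shifts; [B] may be noncommutative,
    hence both inverse conditions. *)
Lemma cheb2_rmorph (B : nzRingType) (phi : {rmorphism {poly F} -> B}) (a b : B) :
  phi 'X = a + b -> a * b = 1 -> b * a = 1 ->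
  forall q, phi (cheb2 q) = a ^+ q + b ^+ q.
Proof.
move=> phiX ab ba; have cheb20 : cheb2 0 = 2%:R.
  by rewrite /cheb2/= comp_polyC alg_polyC polyCMn.
have cheb21 : cheb2 1 = 'X.
  by rewrite /cheb2/= comp_polyX scalerA divff// scale1r.
have cheb2S q : cheb2 q.+2 = 'X * cheb2 q.+1 - cheb2 q.
  rewrite /cheb2 chebTSS comp_polyB comp_polyM comp_polyZ comp_polyX.
  by rewrite scalerBr scalerA divff// scale1r scalerAr.
move=> q; elim/ltn_ind: q => -[|[|q]] IH.
- by rewrite cheb20 rmorph_nat !expr0.
- by rewrite cheb21 phiX !expr1.
rewrite cheb2S rmorphB rmorphM phiX IH// IH; last by rewrite ltnW.
rewrite mulrDl !mulrDr -!exprS (exprS a q) (exprS b q) !mulrA ab ba !mul1r.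
by rewrite (addrC (a ^+ q) (b ^+ q.+2)) addrACA (addrC (b ^+ q)) addrK.
Qed.

Lemma Dpoly_cheb2 k (nu : F) :
  2%:R *: Dpoly k nu = ((2 * k)%:R + nu)%:P - \sum_(q < k) cheb2 q.+1.
Proof.
rewrite /Dpoly scalerBr; congr (_ - _).
  by rewrite -mul_polyC -polyCM mulrDr mulrCA divff// mulr1 -natrM.
by rewrite big_add1/= big_mkord scaler_sumr.
Qed.

Lemma size_chebT q : (size (chebT F q) <= q.+1)%N.
Proof.
elim/ltn_ind: q => -[|[|q]] IH; rewrite ?size_poly1 ?size_polyX//.
rewrite chebTSS (leq_trans (size_polyD _ _))// geq_max size_polyN.
rewrite (leq_trans (IH _ _))// ?andbT; last by rewrite ltnW.
rewrite -scalerAl (leq_trans (size_scale_leq _ _))//.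
rewrite (leq_trans (size_polyMleq _ _))// size_polyX add2n ltnS.
exact: (IH q.+1).
Qed.

Lemma size_Dpoly k (nu : F) : (size (Dpoly k nu) <= k.+1)%N.
Proof.
rewrite (leq_trans (size_polyD _ _))// geq_max size_polyN.
rewrite (leq_trans (size_polyC_leq1 _))// big_add1 big_mkord.
apply: (leq_trans (size_sum _ _ _)); apply/bigmax_leqP => q _.
apply: (leq_trans (size_comp_poly_leq _ _)).
have s2 : (size (2%:R^-1 *: 'X : {poly F}))%R.-1 = 1%N.
  by rewrite size_scale ?invr_eq0// size_polyX.
by rewrite s2 muln1; have := size_chebT q.+1; have := ltn_ord q; lia.
Qed.

(** Lagrange interpolation of the constant 1 at the roots: the cofactor of X - phi_c equals
    D'(phi_c) at phi_c and 0 at the other roots. The difference of the two sides has degree below k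
    and k distinct roots. *)
Lemma partial_fractions k (D : {poly F}) (phi : 'I_k -> F) :
  (0 < k)%N -> (size D <= k.+1)%N -> injective phi ->
  (forall c, root D (phi c)) -> (forall c, D^`().[phi c] != 0) ->
  \sum_c (D^`().[phi c])^-1 *: (D %/ ('X - (phi c)%:P)) = 1.
Proof.
move=> k0 sD phi_inj rD D'0; pose Q c := D %/ ('X - (phi c)%:P).
have DQ c : D = Q c * ('X - (phi c)%:P).
  by rewrite divpK// dvdp_XsubCl.
have Qc c : (Q c).[phi c] = D^`().[phi c].
  by rewrite [in RHS](DQ c) derivM derivXsubC !hornerE subrr mulr0 add0r.
have Qc' c c' : c' != c -> (Q c).[phi c'] = 0.
  move=> cc'; have /eqP := rD c'; rewrite {1}(DQ c) hornerM hornerXsubC.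
  move/eqP; rewrite mulf_eq0 subr_eq0 (inj_eq phi_inj) (negbTE cc') orbF.
  by move/eqP.
apply/eqP; rewrite -subr_eq0; apply/eqP.
apply: (@roots_geq_poly_eq0 _ _ [seq phi c | c : 'I_k]).
- apply/allP => _ /mapP[c _ ->]; rewrite rootE !hornerE horner_sum.
  rewrite (bigD1 c)//= big1 ?addr0 => [|c' c'c].
    by rewrite hornerZ [X in _ * X]Qc mulVf// subrr.
  by rewrite hornerZ [X in _ * X]Qc' ?mulr0// eq_sym.
- by rewrite map_inj_uniq// enum_uniq.
- rewrite size_map size_enum_ord (leq_trans (size_polyD _ _))// geq_max.
  rewrite size_polyN size_poly1 k0 andbT.
  apply: (leq_trans (size_sum _ _ _)); apply/bigmax_leqP => c _.
  apply: (leq_trans (size_scale_leq _ _)).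
  by rewrite size_divp ?polyXsubC_eq0// size_XsubC leq_subLR.
Qed.

End Resolvent.

(** * The Green function of [lap + nu] through resolvents of the cycle *)

Section GreenFunction.
Context (F : numFieldType) (N : nat) (N_gt1 : (1 < N)%N).

Local Notation M := 'M[F]_((Zp_trunc N).+2).

Let shift (a : 'Z_N) : M := \matrix_(i, j) ((j : 'Z_N) == (i : 'Z_N) + a)%:R.

Let colf (f : 'Z_N -> F) : 'cV[F]_((Zp_trunc N).+2) := \col_i f i.

Let shift_colf a f : shift a *m colf f = colf (fun x => f (x + a)).
Proof.
apply/matrixP => i j; rewrite !mxE (bigD1 (i + a : 'Z_N))//= big1 => [|l la].
  by rewrite !mxE eqxx mul1r addr0.
by rewrite !mxE (negbTE la) mul0r.
Qed.

Let shiftM a b : shift a * shift b = shift (a + b).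
Proof.
apply/matrixP => i j; rewrite !mxE (bigD1 (i + a : 'Z_N))//= big1 => [|l la].
  by rewrite !mxE eqxx mul1r addr0 addrA.
by rewrite !mxE (negbTE la) mul0r.
Qed.

Let shift0 : shift 0 = 1.
Proof. by apply/matrixP => i j; rewrite !mxE addr0 eq_sym. Qed.

Let shiftX a q : shift a ^+ q = shift (a *+ q).
Proof. by elim: q => [|q IH]; rewrite ?expr0 ?shift0// exprS IH shiftM mulrS. Qed.

Let adj : M := shift 1 + shift (-1).

(** The shifts by 1 and -1 are mutually inverse, so [cheb2 q] sends their sum to the sum of their
    q-th powers. *)
Let horner_cheb2 q :
  horner_mx adj (cheb2 F q) = shift q%:R + shift (- q%:R).
Proof.
rewrite (cheb2_rmorph _ (a := shift 1) (b := shift (-1))) ?pnatr_eq0//.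
- by rewrite !shiftX mulNrn.
- exact: horner_mx_X.
- by rewrite shiftM subrr shift0.
- by rewrite shiftM addNr shift0.
Qed.

Let horner_Dpoly k (nu : F) f :
  horner_mx adj (2%:R *: Dpoly k nu) *m colf f =
  colf (fun x => lap k f x + nu * f x).
Proof.
rewrite Dpoly_cheb2 ?pnatr_eq0// rmorphB/= horner_mx_C rmorph_sum/=.
under eq_bigr do rewrite horner_cheb2.
rewrite mulmxBl mul_scalar_mx mulmx_suml.
under eq_bigr do rewrite mulmxDl !shift_colf.
apply/matrixP => i j; rewrite !mxE lapE addrAC mulrDl mulr_natl; congr (_ - _).
by rewrite summxE; apply: eq_bigr => q _; rewrite !mxE.
Qed.

(** The numerator is N-periodic and satisfies the recurrence with coefficient rho + 1/rho except at
    0, where its defect is exactly the denominator. *)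
Let res (rho : F) (x : 'Z_N) : F :=
  (rho ^+ x + rho ^+ (N - x)) / ((rho - rho^-1) * (1 - rho ^+ N)).

Let resP rho x : rho != 0 -> rho ^+ 2 != 1 -> rho ^+ N != 1 ->
  res rho (x + 1) + res rho (x - 1) - (rho + rho^-1) * res rho x = (x == 0)%:R.
Proof.
move=> rho0 rho2 rhoN; pose p n := rho ^+ n + rho ^+ (N - n).
have den1 : rho * rho - 1 != 0 by rewrite -expr2 subr_eq0.
have den2 : 1 - rho ^+ N != 0 by rewrite subr_eq0 eq_sym.
have pN : p N = p 0%N by rewrite /p subnn subn0 addrC.
rewrite /res -![_ ^+ _ + _ ^+ (_ - _)]/(p _) (Zp_nextE N_gt1 x pN).
rewrite (Zp_prevE N_gt1 p).
have [->|x0] := eqVneq x 0.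
  case: N N_gt1 @p den2 {pN} => // n _ p den2.
  rewrite /p /= subSS !subn0 subSnn expr0 expr1 exprS.
  rewrite exprS in den2; field.
  by rewrite rho0 den2.
have xN := val_Zp_lt N_gt1 x; have : (0 < x)%N by rewrite lt0n.
move: xN den2; rewrite /p; case: (nat_of_ord x) => // m mN den2 _ /=.
(* With x = m + 1 and N = m + j + 2 the truncated subtractions disappear. *)
have [j ->] : exists j, N = (m + j.+2)%N by exists (N - m.+2)%N; lia.
have -> : (m + j.+2 - m.+2 = j)%N by lia.
have -> : (m + j.+2 - m.+1 = j.+1)%N by lia.
have -> : (m + j.+2 - m = j.+2)%N by lia.
rewrite -mulrDl mulrA -mulrBl (_ : _ - _ = 0) ?mul0r//.
by rewrite !exprS; field.
Qed.

Let horner_res rho : rho != 0 -> rho ^+ 2 != 1 -> rho ^+ N != 1 ->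
  horner_mx adj ('X - (rho + rho^-1)%:P) *m colf (res rho) =
  colf (fun x => (x == 0)%:R).
Proof.
move=> rho0 rho2 rhoN.
rewrite rmorphB/= horner_mx_X horner_mx_C mulmxBl mulmxDl !shift_colf.
by rewrite mul_scalar_mx; apply/matrixP => i j; rewrite !mxE resP.
Qed.

(** The numerators differ by 1 + rho^N - rho^l - rho^(N-l) = (1 - rho^l)(1 - rho^(N-l)). With rho =
    eta^2, each factor is a power of eta times a multiple of a term of [Vseq]. *)
Let res_diff eta l : eta != 0 -> (eta ^+ 2) ^+ 2 != 1 -> (eta ^+ 2) ^+ N != 1 ->
  (l < N)%N ->
  let gamma := eta + eta^-1 in
  res (eta ^+ 2) 0 - res (eta ^+ 2) l%:R =
  - (gamma^-1 * (Vseq gamma l * Vseq gamma (N - l) / Vseq gamma N)).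
Proof.
move=> eta0 eta4 etaN lN gamma.
have e4 : (eta * eta) ^+ 2 - 1 != 0 by rewrite -expr2 subr_eq0.
(* The first factor makes the closed form of [Vseq] divisible by eta - 1/eta; the second makes gamma
   nonzero. *)
have [em ep] : eta * eta - 1 != 0 /\ eta * eta + 1 != 0.
  by apply/andP; rewrite -negb_or -mulf_eq0 -subr_sqr expr1n.
have em0 : eta - eta^-1 != 0.
  have -> : eta - eta^-1 = (eta * eta - 1) / eta by field.
  by rewrite mulf_neq0 ?invr_eq0.
have VE n : Vseq gamma n = (eta ^+ n - eta ^- n) / (eta - eta^-1).
  by rewrite -Vseq_closed// mulrC mulKf.
rewrite !VE /res val_Zp_nat// modn_small//= expr0 subn0.
have [m Nlm] : exists m, N = (l + m)%N by exists (N - l)%N; lia.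
rewrite Nlm addKn -!exprM !(mulnC 2) !exprM !exprD in etaN *.
have := expf_neq0 l eta0; have := expf_neq0 m eta0; move: etaN; rewrite /gamma.
move: (eta ^+ l) (eta ^+ m) => a b; rewrite expr1 -expr2 => ab b0 a0.
have ab' : a * b * (a * b) - 1 != 0 by rewrite -expr2 subr_eq0.
by field; rewrite eta0 em b0 a0 ab' ep e4 -opprB oppr_eq0 ab'.
Qed.

Lemma norm1_of_expr_eq1 (rho : F) n : (0 < n)%N -> rho ^+ n = 1 -> `|rho| = 1.
Proof.
move=> n0 rn; apply/eqP; rewrite -(pexpr_eq1 n0) ?normr_ge0//.
by rewrite -normrX rn normr1.
Qed.

(** On the unit circle each rho^q + rho^-q has norm at most 2, so their sum cannot reach 2k + nu.
    Hence rho is no root of unity, and the denominators of the resolvents do not vanish. *)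
Lemma root_Dpoly_norm k (nu rho : F) : 0 < nu -> rho != 0 ->
  root (Dpoly k nu) (rho + rho^-1) -> `|rho| != 1.
Proof.
move=> nu0 rho0 rD; apply/eqP => rho1.
have : (2%:R *: Dpoly k nu).[rho + rho^-1] = 0 by rewrite hornerZ (rootP rD) mulr0.
rewrite Dpoly_cheb2 ?pnatr_eq0// hornerD hornerN hornerC horner_sum => /eqP.
rewrite subr_eq0 => /eqP E.
have : `|(2 * k)%:R + nu| <= (2 * k)%:R.
  rewrite E (le_trans (ler_norm_sum _ _ _))//.
  apply: (@le_trans _ _ (\sum_(q < k) 2%:R)); last first.
    by rewrite sumr_const card_ord -mulrnA.
  apply: ler_sum => q _.
  rewrite -[_.[_]]/(horner_eval _ _).
  rewrite (cheb2_rmorph _ (a := rho) (b := rho^-1)) ?pnatr_eq0 ?mulfV ?mulVf//;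
    last by rewrite /= /horner_eval hornerX.
  by rewrite (le_trans (ler_normD _ _))// !normrX normfV rho1 invr1 !expr1n.
rewrite ger0_norm; last by rewrite addr_ge0 ?ler0n// ltW.
by rewrite gerDl => /(lt_le_trans nu0); rewrite ltxx.
Qed.

Lemma green_function k (nu : F) (phi rho eta : 'I_k -> F) :
  (0 < k)%N -> 0 < nu -> root_choice nu phi rho eta ->
  (forall c, (Dpoly k nu)^`().[phi c] != 0) ->
  exists2 G : 'Z_N -> F,
    forall x, lap k G x + nu * G x = (x == 0)%:R
  & forall l, (l < N)%N -> Asum nu phi eta N l = - 2%:R * (G 0 - G l%:R).
Proof.
move=> k0 nu0 [phi_inj rD rhoP etaE] D'0.
have two0 : 2%:R != 0 :> F by rewrite pnatr_eq0.
have rDc c : root (Dpoly k nu) (phi c) by apply/rD; exists c.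
have rho0 c : rho c != 0 by case: (rhoP c).
have phiE c : phi c = rho c + (rho c)^-1 by case: (rhoP c).
have rhoX c n : (0 < n)%N -> rho c ^+ n != 1.
  move=> n0; apply/eqP => /(norm1_of_expr_eq1 n0); apply/eqP.
  by apply: (@root_Dpoly_norm k nu) => //; rewrite -phiE.
pose w c := ((Dpoly k nu)^`().[phi c])^-1.
(* The partial fractions of 1/(2 D); the 1/2 is there because [lap + nu] is 2 D(adj). *)
exists (fun x => \sum_c (2%:R^-1 * w c) * res (rho c) x).
  suff : colf (fun x => lap k (fun x => \sum_c (2%:R^-1 * w c) * res (rho c) x) x
      + nu * \sum_c (2%:R^-1 * w c) * res (rho c) x) =
      colf (fun x => (x == 0)%:R).
    by move=> /matrixP E x; have := E x 0; rewrite !mxE.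
  rewrite -horner_Dpoly.
  have -> : colf (fun x => \sum_c (2%:R^-1 * w c) * res (rho c) x) =
      \sum_c (2%:R^-1 * w c) *: colf (res (rho c)).
    by apply/matrixP => i j; rewrite mxE summxE; apply: eq_bigr => c _; rewrite !mxE.
  rewrite mulmx_sumr.
  transitivity (\sum_c horner_mx adj (w c *: (Dpoly k nu %/ ('X - (phi c)%:P))) *m
      colf (fun x => (x == 0)%:R)).
    (* The factor X - phi_c of D turns the resolvent into the unit mass at 0 and leaves the
       cofactor; the weighted cofactors then add up to 1. *)
    apply: eq_bigr => c _; rewrite -scalemxAr linearZ/= -scalemxAl scalerA.
    rewrite mulrAC mulVf// mul1r linearZ/= -scalemxAl; congr (_ *: _).
    rewrite -(@horner_res (rho c))//; [|exact: rhoX|by rewrite rhoX// ltnW].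
    by rewrite -phiE mulmxA -[_ *m horner_mx _ _]rmorphM/= divpK// dvdp_XsubCl.
  rewrite -mulmx_suml -rmorph_sum/= partial_fractions ?rmorph1 ?mul1mx//.
  exact: size_Dpoly.
move=> l lN; rewrite -sumrB mulr_sumr; apply: eq_bigr => c _.
rewrite -mulrBr etaE res_diff//.
- rewrite /gamma_of invfM mul1r -/(w c).
  by move: (w c) (_^-1) (_ / Vseq _ N) => a b t; field.
- by apply: contraNneq (rho0 c) => e0; rewrite etaE e0 expr0n.
- by rewrite -etaE rhoX.
- by rewrite -etaE rhoX// ltnW.
Qed.

End GreenFunction.

(** * The Poisson equation on the circulant graph *)

Section Laplacian.
Context (N : nat) (N_gt1 : (1 < N)%N) (k : nat).

Lemma lap_additive (U V : zmodType) (T : {additive U -> V}) (f : 'Z_N -> U) x :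
  lap k (T \o f) x = T (lap k f x).
Proof.
by rewrite /lap raddf_sum; apply: eq_bigr => q _; rewrite (raddfB T) !mulr2n !(raddfD T).
Qed.

Lemma lap_reflect (U : zmodType) (f : 'Z_N -> U) z x :
  lap k (fun y => f (z - y)) x = lap k f (z - x).
Proof.
apply: eq_bigr => q _; congr (_ - _).
by rewrite [LHS]addrC; congr (f _ + f _); rewrite opprD ?opprK addrA.
Qed.

Lemma lap_lincomb (R : comNzRingType) (f g h : 'Z_N -> R) (a b c : R) x :
  lap k (fun y => f y + g y * a + h y * b - c) x =
  lap k f x + lap k g x * a + lap k h x * b.
Proof.
rewrite /lap !mulr_suml -!big_split/=; apply: eq_bigr => q _; ring.
Qed.

Lemma lap_expand (R : comNzRingType) (f : 'Z_N -> R) x :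
  lap k f x = \sum_i f i * lap k (fun y => (y == i)%:R) x.
Proof.
rewrite /lap; under [RHS]eq_bigr do rewrite mulr_sumr.
rewrite exchange_big/=; apply: eq_bigr => q _.
have fE y : f y = \sum_i f i * (y == i)%:R.
  rewrite (bigD1 y)//= eqxx mulr1 big1 ?addr0// => i iy.
  by rewrite eq_sym (negbTE iy) mulr0.
rewrite {1}(fE x) {1}(fE (x + _)) {1}(fE (x - _)) -sumrMnl -big_split/= -sumrB.
by apply: eq_bigr => i _; ring.
Qed.

Lemma sum_shift (U : nmodType) (f : 'Z_N -> U) a : \sum_x f (x + a) = \sum_x f x.
Proof. by rewrite [RHS](reindex_inj (addIr a)). Qed.

Lemma sum_lap (U : zmodType) (f : 'Z_N -> U) : \sum_x lap k f x = 0.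
Proof.
rewrite exchange_big/=; apply: big1 => q _.
by rewrite sumrB !big_split/= !(sum_shift f) subrr.
Qed.

(** Summation by parts, by translating the summation index by q + 1. *)
Lemma lap_energy (R : comNzRingType) (f : 'Z_N -> R) :
  \sum_x f x * lap k f x = \sum_(q < k) \sum_x (f (x + q.+1%:R) - f x) ^+ 2.
Proof.
under eq_bigr do rewrite mulr_sumr.
rewrite exchange_big/=; apply: eq_bigr => q _.
have -> : \sum_x f x * (f x *+ 2 - (f (x + q.+1%:R) + f (x - q.+1%:R))) =
    \sum_x (f x ^+ 2 + f x ^+ 2 - f x * f (x + q.+1%:R)) -
    \sum_x f x * f (x - q.+1%:R).
  by rewrite -sumrB; apply: eq_bigr => x _; ring.
rewrite -[X in _ - X](sum_shift (fun x => f x * f (x - q.+1%:R)) q.+1%:R).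
have -> : \sum_x (f x ^+ 2 + f x ^+ 2 - f x * f (x + q.+1%:R)) =
    \sum_x (f (x + q.+1%:R) ^+ 2 + f x ^+ 2 - f x * f (x + q.+1%:R)).
  by rewrite !sumrB !big_split/= (sum_shift (fun x => f x ^+ 2)).
by rewrite -sumrB; apply: eq_bigr => x _; rewrite addrK; ring.
Qed.

Section Poisson.
Context (R : realFieldType) (k_gt0 : (0 < k)%N).

Lemma lap_kernel (f : 'Z_N -> R) z : f z = 0 ->
  (forall x, x != z -> lap k f x = 0) -> forall x, f x = 0.
Proof.
move=> fz fx; have E0 : \sum_x f x * lap k f x = 0.
  apply: big1 => x _; have [->|/fx->] := eqVneq x z; first by rewrite fz mul0r.
  by rewrite mulr0.
have f1 x : f (x + 1) = f x.
  move/eqP: E0; rewrite lap_energy psumr_eq0 => [|q _]; last first.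
    by apply: sumr_ge0 => y _; exact: sqr_ge0.
  (* Index 0 is the step of length 1, whose vanishing energy already makes [f] constant along the
     cycle. *)
  move=> /allP/(_ (Ordinal k_gt0) (mem_index_enum _))/=.
  rewrite psumr_eq0 => [|y _]; last exact: sqr_ge0.
  move=> /allP/(_ x (mem_index_enum _))/=.
  by rewrite sqrf_eq0 subr_eq0 => /eqP.
have f0 x : f x = f 0.
  rewrite -[x]natr_Zp; elim: (nat_of_ord x) => [//|n IH].
  by rewrite -natr1 f1.
by move=> x; rewrite f0 -(f0 z).
Qed.

Lemma poisson_solvable (z : 'Z_N) (g : 'Z_N -> R) :
  exists2 f : 'Z_N -> R, f z = 0 & forall x, x != z -> lap k f x = g x.
Proof.
(* The Laplace system with the equation at [z] replaced by evaluation at [z]; by [lap_kernel] this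
   square system is injective, hence invertible. *)
pose A : 'M[R]_((Zp_trunc N).+2) := \matrix_(i, j)
  if (j : 'Z_N) == z then ((i : 'Z_N) == z)%:R
  else lap k (fun y => (y == (i : 'Z_N))%:R) (j : 'Z_N).
have AE (u : 'rV_((Zp_trunc N).+2)) j :
    (u *m A) 0 j = if (j : 'Z_N) == z then u 0 z else lap k (u 0) (j : 'Z_N).
  rewrite mxE; case: ifPn => jz.
    rewrite (bigD1 z)//= mxE jz eqxx mulr1 big1 ?addr0// => i iz.
    by rewrite mxE jz (negbTE iz) mulr0.
  by rewrite lap_expand; apply: eq_bigr => i _; rewrite mxE (negbTE jz).
have A_unit : A \in unitmx.
  rewrite -row_free_unit -kermx_eq0; apply/rowV0P => u /sub_kermxP uA.
  apply/rowP => x; rewrite mxE; apply: (@lap_kernel (u 0) z).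
    by have := AE u z; rewrite uA mxE eqxx.
  by move=> y yz; have := AE u y; rewrite uA mxE (negbTE yz).
pose b : 'rV[R]_((Zp_trunc N).+2) := \row_j if (j : 'Z_N) == z then 0 else g j.
exists ((b *m invmx A) 0) => [|x xz].
  by have := AE (b *m invmx A) z; rewrite mulmxKV// mxE eqxx.
by have := AE (b *m invmx A) x; rewrite mulmxKV// mxE (negbTE xz).
Qed.

(** A Laplacian sums to 0, so its value at [z] must be -2k(N - 1). *)
Lemma lap_at_target (f : 'Z_N -> R) z :
  (forall x, x != z -> lap k f x = (2 * k)%:R) ->
  forall x, lap k f x = (2 * k)%:R - (x == z)%:R * (2 * k * N)%:R.
Proof.
move=> fx x; have [->|xz] := eqVneq x z; last by rewrite mul0r subr0 fx.
have := sum_lap f; rewrite (bigD1 z)//= (eq_bigr (fun=> (2 * k)%:R))//.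
move/eqP; rewrite addr_eq0 => /eqP ->.
rewrite sumr_const cardC1 card_ord Zp_cast// mul1r.
have -> : (2 * k * N = 2 * k + 2 * k * N.-1)%N by rewrite -mulnS prednK// ltnW.
by rewrite natrD opprD addrA subrr sub0r -mulrnA.
Qed.

End Poisson.
End Laplacian.

(** * Walks on the circulant graph and on its product with K_{s,s} *)

Section Walks.
Context (R : realType).

Lemma step_sumE (V : finType) (e : rel V) (deg : R) (h : V -> R) x :
  deg != 0 -> \sum_(y | e x y) 1 = deg ->
  deg * h x - \sum_(y | e x y) h y = deg ->
  h x = 1 + \sum_y step_prob e x y * h y.
Proof.
move=> deg0 degE hE; have -> : \sum_y step_prob e x y * h y =
    deg^-1 * \sum_(y | e x y) h y.
  rewrite mulr_sumr [RHS]big_mkcond/=; apply: eq_bigr => y _.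
  rewrite /step_prob; case: ifP => exy; last by rewrite mul0r.
  congr (_^-1 * _); rewrite -degE sumr_const; congr (1 *+ _).
  by apply: eq_card => z; rewrite inE.
have -> : \sum_(y | e x y) h y = deg * h x - deg.
  by rewrite -[X in _ - X]hE opprB addrC subrK.
by field.
Qed.

(** Irreflexivity of [e] keeps the two kinds of edges disjoint, so no neighbour is counted twice. *)
Lemma sum_cart_adj (T U : finType) (e : rel T) (f : rel U) (F : nmodType)
    (h : T * U -> F) x :
  irreflexive e ->
  \sum_(y | cart_adj e f x y) h y =
  \sum_(t | e x.1 t) h (t, x.2) + \sum_(u | f x.2 u) h (x.1, u).
Proof.
move=> e_irr; rewrite (bigID (fun y => (x.2 == y.2) && e x.1 y.1))/=.
congr (_ + _).
  transitivity (\sum_(t | e x.1 t) \sum_(u | u == x.2) h (t, u)).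
    rewrite pair_big_dep/=; apply: eq_big => [[t u]|[t u] _]//=.
    by rewrite /cart_adj/= eq_sym; case: (u == _); case: (e _ _); rewrite /= ?andbF.
  by apply: eq_bigr => t _; rewrite big_pred1_eq.
transitivity (\sum_(t | t == x.1) \sum_(u | f x.2 u) h (t, u)).
  rewrite pair_big_dep/=; apply: eq_big => [[t u]|[t u] _]//=.
  rewrite /cart_adj/= [t == _]eq_sym; have [<-|] := eqVneq x.1 t.
    by rewrite e_irr andbF/= andbT.
  by rewrite orbF andbN.
by rewrite big_pred1_eq.
Qed.

Lemma sum_complete_bip (F : nmodType) s (g : bool * 'I_s -> F) b :
  \sum_(y | @complete_bip_adj s b y) g y = \sum_i g (~~ b.1, i).
Proof.
transitivity (\sum_(t | t == ~~ b.1) \sum_(i : 'I_s) g (t, i)).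
  rewrite pair_big_dep/=; apply: eq_big => [[t i]|[t i] _]//=.
  by rewrite /complete_bip_adj/= andbT; case: (b.1); case: t.
by rewrite big_pred1_eq.
Qed.

Context (N k : nat) (k_gt0 : (0 < k)%N) (N_ge : (2 * k + 1 <= N)%N).

Let N_gt1 : (1 < N)%N. Proof. by lia. Qed.

Lemma circulant_irr : irreflexive (@circulant_adj N k).
Proof.
move=> x; apply/negbTE; rewrite negb_exists; apply/forallP => q.
rewrite subrr eq_sym [0 == - _]eq_sym oppr_eq0 orbb.
by apply: Zp_natr_neq0 => //; have := ltn_ord q; lia.
Qed.

Lemma mean_hitting_circulant d (Omega : measurableType d)
    (P : probability Omega R) (W : nat -> Omega -> 'Z_N) u z (h : 'Z_N -> R) :
  simple_random_walk P (@circulant_adj N k) u W ->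
  h z = 0 -> (forall x, x != z -> lap k h x = (2 * k)%:R) ->
  mean_hitting_time P W z = (h u)%:E.
Proof.
move=> walkW hz hx; apply: (mean_hitting_timeE walkW hz) => x xz.
apply: (@step_sumE _ _ (2 * k)%:R).
- by rewrite pnatr_eq0; lia.
- by rewrite circulant_neighbours// sumr_const card_ord -mulr2n -mulrnA.
- by rewrite circulant_neighbours// -[RHS](hx x xz) lapE mulr_natl.
Qed.

Context (s : nat) (s_gt0 : (0 < s)%N).

(* [r] and [sg] are the eigenvectors of eigenvalues [s] and [2s] of the Laplacian
   of K_{s,s} in the decomposition of [2s] times the unit mass at [a]:
   [1 + 2s r + sg]. *)
Lemma mean_hitting_product d (Omega : measurableType d)
    (P : probability Omega R) (Z : nat -> Omega -> 'Z_N * (bool * 'I_s))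
    (a : bool * 'I_s) (z : 'Z_N) (H G1 G2 : 'Z_N -> R) :
  simple_random_walk P (cart_adj (@circulant_adj N k) (@complete_bip_adj s))
    (0, a) Z ->
  H z = 0 -> (forall x, x != z -> lap k H x = (2 * k)%:R) ->
  (forall x, lap k G1 x + s%:R * G1 x = (x == 0)%:R) ->
  (forall x, lap k G2 x + (2 * s)%:R * G2 x = (x == 0)%:R) ->
  mean_hitting_time P Z (z, a) =
  ((2 * k + s)%:R / (2 * k)%:R * H 0
   + (N * (2 * k + s))%:R
     * ((2 * s - 2)%:R * (G1 0 - G1 z) + (G2 0 - G2 z)))%:E.
Proof.
move=> walkZ Hz Hx G1x G2x.
have s0 : s%:R != 0 :> R by rewrite pnatr_eq0; lia.
have k0 : k%:R != 0 :> R by rewrite pnatr_eq0; lia.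
pose r (b : bool * 'I_s) : R := (b == a)%:R - (b.1 == a.1)%:R / s%:R.
pose sg (b : bool * 'I_s) : R := if b.1 == a.1 then 1 else -1.
have sum_r t : \sum_(i : 'I_s) r (t, i) = 0.
  rewrite /r sumrB/= sumr_const card_ord -[X in _ - X]mulr_natr mulfVK//.
  under eq_bigr => i _ do rewrite -[_ == a]/((t == a.1) && (i == a.2)).
  have [_|_] := eqVneq t a.1; last by rewrite big1 ?subrr.
  by rewrite (bigD1 a.2)//= eqxx big1 ?addr0 ?subrr// => i /negbTE->.
pose D : R := (2 * k + s)%:R.
(* [D] is the degree of the product graph. The weights make the sources of the three components at
   [z] equal to -ND times 1, 2s r and sg; together they form -2sND times the unit mass at [a]. The
   argument [z - x] moves the poles of [G1] and [G2] to [z], and [C] makes [h] vanish at the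
   target. *)
pose H0 x := D / (2 * k)%:R * H x.
pose H1 x := - ((2 * s * N)%:R * D) * G1 (z - x).
pose H2 x := - (N%:R * D) * G2 (z - x).
pose C := H0 z + H1 z * r a + H2 z * sg a.
pose h (y : 'Z_N * (bool * 'I_s)) := H0 y.1 + H1 y.1 * r y.2 + H2 y.1 * sg y.2 - C.
have lapZ c (f : 'Z_N -> R) x : lap k (fun y => c * f y) x = c * lap k f x.
  by rewrite /lap mulr_sumr; apply: eq_bigr => q _; ring.
have zx x : (z - x == 0) = (x == z) by rewrite subr_eq0 eq_sym.
have lapH0 x : lap k H0 x = D - N%:R * D * (x == z)%:R.
  rewrite lapZ (lap_at_target N_gt1 Hx) !natrM; field.
  by [].
have lapH1 x : lap k H1 x + s%:R * H1 x = - ((2 * s * N)%:R * D) * (x == z)%:R.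
  by rewrite lapZ lap_reflect -zx -G1x /H1; ring.
have lapH2 x : lap k H2 x + (2 * s)%:R * H2 x = - (N%:R * D) * (x == z)%:R.
  by rewrite lapZ lap_reflect -zx -G2x /H2; ring.
have hza : h (z, a) = 0 by rewrite /h subrr.
rewrite (mean_hitting_timeE walkZ hza).
  (* The coefficient 2s - 2 arises as 2s times r(a) = 1 - 1/s. *)
  congr (_%:E); rewrite /h /C /= /H0 /H1 /H2 /r /sg !eqxx mulr1n subr0 subrr Hz /D.
  rewrite natrB; last by lia.
  by rewrite !(natrM, natrD); field; rewrite s0 k0.
move=> [x b] xb; apply: (@step_sumE _ _ D); first by rewrite pnatr_eq0; lia.
  rewrite (sum_cart_adj _ _ _ circulant_irr) circulant_neighbours// sum_complete_bip.
  by rewrite !sumr_const !card_ord -mulr2n -mulrnA -mulrnDr.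
rewrite (sum_cart_adj _ _ _ circulant_irr) sum_complete_bip/= circulant_neighbours//.
have sg_opp i : sg (~~ b.1, i) = - sg b.
  by rewrite /sg/=; case: b.1; case: a.1; rewrite ?opprK.
(* On the opposite side [r] sums to 0 and [sg] changes sign: these are the eigenvalues s and 2s. *)
have -> : \sum_i h (x, (~~ b.1, i)) = s%:R * (H0 x - H2 x * sg b - C).
  transitivity (\sum_(i < s) (H0 x - H2 x * sg b - C + H1 x * r (~~ b.1, i))).
    by apply: eq_bigr => i _; rewrite /h/= sg_opp; ring.
  by rewrite big_split/= -mulr_sumr sum_r mulr0 addr0 sumr_const card_ord mulr_natl.
have -> : \sum_(q < k) (h (x + q.+1%:R, b) + h (x - q.+1%:R, b)) =
    (2 * k)%:R * h (x, b) - lap k (fun y => h (y, b)) x.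
  by rewrite lapE mulr_natl opprB addrC subrK.
rewrite /h/= lap_lincomb.
have E : lap k H0 x + r b * (lap k H1 x + s%:R * H1 x)
    + sg b * (lap k H2 x + (2 * s)%:R * H2 x) = D.
  rewrite lapH0 lapH1 lapH2.
  (* In the fibre over [z] the vertex differs from [a], and there 1 + 2s r + sg = 0. *)
  have [xz|xz] := eqVneq x z; last by rewrite mulr0n; ring.
  have ba : b != a by apply: contraNneq xb => ->; rewrite xz.
  rewrite /r /sg (negbTE ba); case: eqP => _; rewrite ?mulr1n ?mulr0n !natrM; field => //.
rewrite -[RHS]E /D !(natrM, natrD); ring.
Qed.

End Walks.

(** * Simple roots and explicit solutions on the plain cycle *)

Lemma simple_roots_deriv (F : fieldType) (p : {poly F}) x :
  simple_roots p -> root p x -> p^`().[x] != 0.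
Proof.
move=> p_simple rx; have mx := p_simple x rx.
have p0 : p != 0.
  (* [mup] is a maximum over ordinals bounded by the size, so it is 0 for the zero polynomial. *)
  apply: contra_eq_neq mx => ->; apply/eqP; rewrite /mup.
  by case: arg_maxnP => //= i _ _; case: i => [[]//= m]; rewrite size_poly0.
apply/eqP => p'x; suff : (1 < mup x p)%N by rewrite mx.
have [q pq] := factor_theorem p x rx.
have rq : root q x.
  move: p'x; rewrite pq derivM derivXsubC !hornerE subrr mulr0 add0r.
  by move=> /eqP.
by rewrite mup_geq// expr2 pq dvdp_mul// dvdp_XsubCl.
Qed.

(** The gambler's ruin solution: n(N - n) has second difference -2 and equal values at 0 and N. *)
Lemma poisson_cycle (R : realFieldType) (N : nat) (z : 'Z_N) :
  (1 < N)%N ->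
  let H (x : 'Z_N) : R := ((z - x : 'Z_N)%R * (N - (z - x : 'Z_N)%R))%:R in
  forall x, x != z -> lap 1 H x = 2%:R.
Proof.
move=> N_gt1 H x xz; pose p n : R := (n * (N - n))%:R.
have yz : z - x != 0 by rewrite subr_eq0 eq_sym.
have pN : p N = p 0%N by rewrite /p subnn muln0 mul0n.
rewrite (lap_reflect 1 (fun w : 'Z_N => p w)).
move: (z - x : 'Z_N) yz => y yz.
have -> : lap 1 (fun w : 'Z_N => p w) y =
    p y *+ 2 - (p (y + 1 : 'Z_N) + p (y - 1 : 'Z_N)) by rewrite /lap big_ord1.
rewrite (Zp_nextE N_gt1 _ pN) (Zp_prevE N_gt1 p) (negbTE yz).
have yN := val_Zp_lt N_gt1 y; have : (0 < y)%N by rewrite lt0n.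
move: yN; rewrite /p; case: (nat_of_ord y) => // m mN _.
have -> : N = (m + (N - m.+2) + 2)%N by lia.
move: (N - m.+2)%N => j; rewrite /=.
have -> : (m + j + 2 - m.+2 = j)%N by lia.
have -> : (m + j + 2 - m.+1 = j.+1)%N by lia.
have -> : (m + j + 2 - m = j.+2)%N by lia.
by ring.
Qed.

(* For k = 1 the only root of D_{1,nu} is nu + 2, for which gamma^2 = nu + 4. *)
Lemma green_function_cycle (R : realType) (N : nat) (nu : R) :
  (1 < N)%N -> 0 < nu ->
  exists2 G : 'Z_N -> R,
    forall x, lap 1 G x + nu * G x = (x == 0)%:R
  & forall l, (l < N)%N -> let g := Num.sqrt (nu + 4) in
      G 0 - G l%:R = (Vseq g l * Vseq g (N - l) / Vseq g N) / g.
Proof.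
move=> N_gt1 nu0; set g := Num.sqrt (nu + 4); pose t := Num.sqrt nu.
have g2 : g ^+ 2 = nu + 4 by rewrite sqr_sqrtr// addr_ge0// ltW.
have t2 : t ^+ 2 = nu by rewrite sqr_sqrtr// ltW.
have g0 : 0 < g by rewrite sqrtr_gt0 ltr_wpDr.
have t0 : 0 < t by rewrite sqrtr_gt0.
(* Since g^2 - t^2 = 4, the inverse is (g - t)/2 and the sum of both is g. As [eta] is real, the
   general Green function can be taken over [R] itself. *)
pose eta := (g + t) / 2.
have eta0 : eta != 0 by rewrite gt_eqF// divr_gt0// addr_gt0.
have etaV : eta^-1 = (g - t) / 2.
  apply: (mulfI eta0); rewrite divff// /eta mulrACA [(g + t) * _]mulrC.
  by rewrite -subr_sqr g2 t2; field.
have gE : eta + eta^-1 = g by rewrite etaV /eta; field.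
have DE : Dpoly 1 nu = (1 + nu / 2)%:P - 2^-1 *: 'X.
  by rewrite /Dpoly big_nat1 comp_polyX.
have D'E x : (Dpoly 1 nu)^`().[x] = - 2^-1.
  by rewrite DE derivB derivC derivZ derivX sub0r hornerN hornerZ hornerC mulr1.
have choice : root_choice nu (fun=> nu + 2) (fun=> eta ^+ 2) (fun _ : 'I_1 => eta).
  split=> //.
  - by move=> i j _; rewrite !ord1.
  - move=> x; rewrite DE rootE !hornerE; split.
      move=> /eqP Dx; exists ord0 => /=; lra.
    by move=> [_ <-] /=; apply/eqP; field.
  - move=> _; split; first by rewrite expf_neq0.
    have -> : eta ^+ 2 + (eta ^+ 2)^-1 = (eta + eta^-1) ^+ 2 - 2 by field.
    by rewrite gE g2; ring.
have D'0 (c : 'I_1) : (Dpoly 1 nu)^`().[nu + 2] != 0.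
  by rewrite D'E oppr_eq0 invr_eq0 pnatr_eq0.
have [G Gx GA] := green_function N_gt1 (ltn0Sn 0) nu0 choice D'0.
exists G => // l lN; have := GA l lN.
rewrite /Asum big_ord1 /gamma_of gE D'E => E.
apply: (@mulfI _ (- 2)); first by rewrite oppr_eq0 pnatr_eq0.
rewrite -E; move: (_ / Vseq g N) => v; field.
by rewrite gt_eqF.
Qed.

(** * Assembly of the general formula and of the case k = 1 *)

Theorem corollary6p8 (R : realType) (N k s : nat)
  (k_gt0 : (0 < k)%N) (N_ge : (2 * k + 1 <= N)%N) (s_ge2 : (2 <= s)%N)
  (simple_s : simple_roots (Dpoly k (s%:R : R[i])))
  (simple_2s : simple_roots (Dpoly k ((2 * s)%:R : R[i])))
  (a : bool * 'I_s) (l : nat) (l_le : (l <= N - 1)%N)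
  (d : measure_display) (Omega : measurableType d) (P : probability Omega R)
  (Z : nat -> Omega -> 'Z_N * (bool * 'I_s))
  (walkZ : simple_random_walk P
     (cart_adj (@circulant_adj N k) (@complete_bip_adj s)) (0, a) Z) :
  (forall (d' : measure_display) (Omega' : measurableType d')
      (P' : probability Omega' R) (W : nat -> Omega' -> 'Z_N)
      (phi1 rho1 eta1 phi2 rho2 eta2 : 'I_k -> R[i]),
    simple_random_walk P' (@circulant_adj N k) 0 W ->
    root_choice (s%:R : R[i]) phi1 rho1 eta1 ->
    root_choice ((2 * s)%:R : R[i]) phi2 rho2 eta2 ->
    [/\ mean_hitting_time P Z (l%:R, a) \is a fin_num,
        mean_hitting_time P' W l%:R \is a fin_num
      & (fine (mean_hitting_time P Z (l%:R, a)))%:C =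
        (2 * k + s)%:R / (2 * k)%:R
          * (fine (mean_hitting_time P' W l%:R))%:C
        - (N * (2 * k + s))%:R / 2
          * ((2 * s - 2)%:R * Asum (s%:R : R[i]) phi1 eta1 N l
             + Asum ((2 * s)%:R : R[i]) phi2 eta2 N l)])
  /\
  (k = 1%N ->
    mean_hitting_time P Z (l%:R, a) =
    ((s + 2)%:R / 2 * (l * (N - l))%:R
     + (N * (s + 2))%:R
       * ((2 * s - 2)%:R / Num.sqrt (s%:R + 4)
            * (Vseq (Num.sqrt (s%:R + 4)) l
               * Vseq (Num.sqrt (s%:R + 4)) (N - l)
               / Vseq (Num.sqrt (s%:R + 4)) N)
          + 1 / Num.sqrt ((2 * s)%:R + 4)
            * (Vseq (Num.sqrt ((2 * s)%:R + 4)) l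
               * Vseq (Num.sqrt ((2 * s)%:R + 4)) (N - l)
               / Vseq (Num.sqrt ((2 * s)%:R + 4)) N)))%:E).
Proof.
have N_gt1 : (1 < N)%N by lia.
have s_gt0 : (0 < s)%N by lia.
have lN : (l < N)%N by lia.
split=> [d' Omega' P' W phi1 rho1 eta1 phi2 rho2 eta2 walkW choice1 choice2|k1].
  have [H Hl Hx] := @poisson_solvable N k R k_gt0 l%:R (fun=> (2 * k)%:R).
  have simple_green m (phi rho eta : 'I_k -> R[i]) : (0 < m)%N ->
      simple_roots (Dpoly k (m%:R : R[i])) -> root_choice (m%:R : R[i]) phi rho eta ->
      exists2 G : 'Z_N -> R[i],
        forall x, lap k G x + m%:R * G x = (x == 0)%:R
      & forall l, (l < N)%N -> Asum (m%:R : R[i]) phi eta N l = - 2%:R * (G 0 - G l%:R).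
    move=> m0 simple_m choice.
    apply: (green_function N_gt1 k_gt0 _ choice); first by rewrite ltr0n.
    move=> c; apply: simple_roots_deriv => //.
    by case: choice => _ rD _ _; apply/rD; exists c.
  have [G1 G1x G1A] := simple_green _ _ _ _ s_gt0 simple_s choice1.
  have [|G2 G2x G2A] := simple_green _ _ _ _ _ simple_2s choice2; first by lia.
  pose A0 := (2 * s - 2)%:R * (G1 0 - G1 l%:R) + (G2 0 - G2 l%:R).
  (* [Re] and [Re + Im] both map the complex Green functions to real ones, so they
     give the same hitting time and [A0] is real. *)
  have hit (T : {additive R[i] -> R}) : T 1 = 1 -> mean_hitting_time P Z (l%:R, a) =
      ((2 * k + s)%:R / (2 * k)%:R * H 0 + (N * (2 * k + s))%:R * T A0)%:E.
    move=> T1; have Tn n : T n%:R = n%:R by rewrite (raddfMn T) T1.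
    have TM n x : T (n%:R * x) = n%:R * T x by rewrite !mulr_natl (raddfMn T).
    rewrite /A0 (raddfD T) TM !(raddfB T).
    apply: (mean_hitting_product k_gt0 N_ge s_gt0
      (G1 := T \o G1) (G2 := T \o G2) walkZ Hl Hx) => x.
      by rewrite lap_additive/= -TM -(raddfD T) G1x Tn.
    by rewrite lap_additive/= -TM -(raddfD T) G2x Tn.
  have Re_morph : zmod_morphism (@complex.Re R : R[i] -> R) by move=> [? ?] [? ?].
  have Re_Im_morph : zmod_morphism (fun z : R[i] => complex.Re z + complex.Im z).
    by move=> [? ?] [? ?] /=; ring.
  pose T0 : {additive R[i] -> R} :=
    HB.pack (@complex.Re R : R[i] -> R) (GRing.isZmodMorphism.Build _ _ _ Re_morph).
  pose T1 : {additive R[i] -> R} :=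
    HB.pack (fun z : R[i] => complex.Re z + complex.Im z)
      (GRing.isZmodMorphism.Build _ _ _ Re_Im_morph).
  have hitRe := hit T0 erefl.
  (* Equating the two expressions for the hitting time leaves N(2k + s) Im A0 = 0. *)
  have Im0 : complex.Im A0 = 0.
    have := hit T1 (addr0 1); rewrite hitRe => -[] /addrI/mulfI.
    rewrite pnatr_eq0 /= => /(_ _)/eqP; rewrite -subr_eq0 opprD addNKr oppr_eq0.
    by move=> E; apply/eqP/E; lia.
  have A0E : (complex.Re A0)%:C = A0 by apply/eqP; rewrite eq_complex /= Im0 !eqxx.
  have hitW := mean_hitting_circulant k_gt0 N_ge walkW Hl Hx.
  rewrite hitRe hitW; split=> //=.
  (* Each [Asum] is -2 times a difference of Green values, which accounts for the sign and the 1/2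
     in the formula. *)
  rewrite G1A// G2A// -[RHS]/(_ - _) rmorphD !rmorphM/= fmorphV/= !rmorph_nat A0E /A0.
  field.
  by rewrite pnatr_eq0; lia.
subst k.
have mu0 m : (0 < m)%N -> 0 < m%:R :> R by rewrite ltr0n.
have [G1 G1x G1l] := green_function_cycle N_gt1 (mu0 _ s_gt0).
have [|G2 G2x G2l] := green_function_cycle N_gt1 (mu0 (2 * s)%N _); first by lia.
(* For k = 1 the explicit solution takes the value l(N - l) at 0. *)
have Hx := @poisson_cycle R N l%:R N_gt1.
rewrite (mean_hitting_product k_gt0 N_ge s_gt0 walkZ _ Hx G1x G2x); last first.
  by rewrite subrr mul0n.
congr (_%:E); rewrite G1l// G2l// subr0 val_Zp_nat// modn_small//.
rewrite !muln1 [(2 + s)%N]addnC; congr (_ + _ * _).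
by rewrite [1 / _ * _]mulrC mul1r [(2 * s - 2)%:R / _ * _]mulrAC mulrA.
Qed.
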